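(* For every integer $n\geq 1$ there exists a connected graph $G$ with $n$ vertices such that $b_{\mathsf{fa}}(G)=\lceil\log_2 n\rceil$, i.e., there is a collection of lists $(\ell_v)_{v\in V(G)}$ such that, in the fully-adaptive source-oblivious model, broadcast from every source vertex completes in $\lceil\log_2 n\rceil$ rounds. In particular, for every $n\geq 1$, the complete graph $K_n$ satisfies $b_{\mathsf{fa}}(K_n)=\lceil\log_2 n\rceil$.
   Context: Broadcasting in a connected graph $G$: initially only a source vertex $s$ holds a message; time proceeds in synchronous rounds, and in each round every informed vertex may transmit the message to at most one of its neighbors. Fully-adaptive source-oblivious model: each vertex $v$ is assigned a single ordered list $\ell_v=(u_1,\dots,u_k)$ of distinct neighbors of $v$ (independent of the source). Once $v$ is informed, in each subsequent round it sends the message to the first vertex of $\ell_v$ that is not already informed at the start of that round (informed neighbors are skipped, since every vertex is aware which of its neighbors are informed); $v$ stops when all vertices in its list are informed. For a family of lists $L=(\ell_v)_{v\in V(G)}$ and a source $s$, $b_{\mathsf{fa}}(G,s,L)$ denotes the number of rounds until all vertices are informed, and $b_{\mathsf{fa}}(G)=\min_L\max_{s\in V(G)} b_{\mathsf{fa}}(G,s,L)$. *)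

(* Defs.v *)
From mathcomp Require Import all_boot.

Set Implicit Arguments.
Unset Strict Implicit.
Unset Printing Implicit Defensive.

Record sgraph := SGraph {
  vertex :> finType;
  adj : rel vertex;
  adj_sym : symmetric adj;
  adj_irr : irreflexive adj
}.

Definition connected (G : sgraph) : Prop :=
  forall x y : G, connect (@adj G) x y.

Definition complete_adj (n : nat) : rel 'I_n := fun x y => x != y.

Lemma complete_adj_sym n : symmetric (@complete_adj n).
Proof. by move=> x y; rewrite /complete_adj eq_sym. Qed.

Lemma complete_adj_irr n : irreflexive (@complete_adj n).
Proof. by move=> x; rewrite /complete_adj eqxx. Qed.

Definition complete_graph (n : nat) : sgraph :=
  SGraph (@complete_adj_sym n) (@complete_adj_irr n).

Section FullyAdaptive.
Variable G : sgraph.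
Implicit Types (L : G -> seq G) (s v : G) (I : {set G}) (t k : nat).

(* A list need not contain all the neighbours of its vertex. *)
Definition list_family L : Prop :=
  forall v, uniq (L v) /\ {subset L v <= adj v}.

Definition target L I v : option G := ohead [seq u <- L v | u \notin I].

Definition fa_round L I : {set G} :=
  I :|: [set u | [exists v in I, target L I v == Some u]].

Definition informed L s t : {set G} := iter t (fa_round L) [set s].

(* [b_fa_src L s t], [b_fa_max L t] and [b_fa k] are the graphs of the partial
   functions b_fa(G,s,L), max_s b_fa(G,s,L) and b_fa(G) = min_L max_s
   b_fa(G,s,L).  The first two have no value (infinite time) when the lists L
   never inform all the vertices; such L do not compete in the minimum. *)
Definition b_fa_src L s t : Prop :=
  informed L s t = [set: G] /\
  forall t', t' < t -> informed L s t' <> [set: G].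

Definition b_fa_max L t : Prop :=
  (exists s, b_fa_src L s t) /\
  forall s, exists2 t', b_fa_src L s t' & t' <= t.

Definition b_fa k : Prop :=
  (exists2 L, list_family L & b_fa_max L k) /\
  forall L k', list_family L -> b_fa_max L k' -> k <= k'.

End FullyAdaptive.

(* Main.v *)
Require Import Defs.
From mathcomp Require Import all_boot.
From mathcomp Require Import zify.

Set Implicit Arguments.
Unset Strict Implicit.
Unset Printing Implicit Defensive.

(** The informed set at most doubles in a round, which gives the lower bound.

    For the upper bound, lists for [K_n] with [n <= 2 ^ k] are built by
    induction on [k], together with the invariant that if [n < 2 ^ k] then, from
    every source, some informed vertex has nothing left to send in round [k].
    Rounds are monotone in the informed set, so appending vertices to the lists
    of a sub-clique never slows down the broadcast inside it.

    - If [n = 2 m], take two copies of [K_m] and append to each list the twin of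
      its vertex: one half is informed after [k - 1] rounds, and round [k]
      crosses the matching.  A vertex idle in round [k - 1] of its half informs
      its twin in that round and is idle in round [k].
    - If [n = 2 m + 1], take [A = K_(m+1)] and [B = K_m].  Pick [a'] in [A], let
      [a0] be the head of its list, and match [B] with [A - a0].  Append to the
      lists of [A - a0] the partner in [B], and to each list of [B] first [a']
      and then the partner.  From a source in [A], round [k] crosses the
      matching and [a0] is idle.  From a source in [B], a vertex idle in round
      [k - 1] of [B] informs [a'], so that in round [k] the matching is crossed,
      [a'] informs [a0], and the partner of [a'] is idle. *)

(** * Single rounds and the doubling bound *)

Section Rounds.
Variable G : sgraph.
Implicit Types (L : G -> seq G) (I : {set G}) (s u v : G).

Lemma fa_round_sub L I : I \subset fa_round L I.
Proof. exact: subsetUl. Qed.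

(** The prefix [r1] consists of the entries that [v] skips. Since [u] itself may already lie in [I],
    the right-hand side is visibly monotone in [I]. *)
Lemma fa_roundP L I u :
  reflect (u \in I \/ exists v r1 r2,
             [/\ v \in I, L v = r1 ++ u :: r2 & {subset r1 <= I}])
          (u \in fa_round L I).
Proof.
rewrite /fa_round inE; apply: (iffP orP) => -[uI|]; try by left.
  rewrite inE => /exists_inP[v vI /eqP tv]; right; exists v.
  move: tv; rewrite /target; elim: (L v) => //= x l IHl.
  case: ifP => [xI [<-]|/negbFE xI /IHl[r1 [r2 [_ -> sI]]]].
    by exists [::], l.
  exists (x :: r1), r2; split=> // y.
  by rewrite inE => /orP[/eqP-> //|/sI].
case=> v [r1 [r2 [vI Lv sI]]].
have [uI|uNI] := boolP (u \in I); [by left | right].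
rewrite inE; apply/exists_inP; exists v => //.
rewrite /target Lv filter_cat (_ : [seq x <- r1 | x \notin I] = [::]).
  by rewrite /= uNI.
by apply/eqP; rewrite -(negbK (_ == _)) -has_filter; apply/hasPn=> x /sI ->.
Qed.

Lemma fa_round_send L I v r1 u r2 :
    L v = r1 ++ u :: r2 -> v \in I -> {subset r1 <= I} -> u \in fa_round L I.
Proof. by move=> Lv vI sI; apply/fa_roundP; right; exists v, r1, r2. Qed.

Lemma informedS L s t : informed L s t.+1 = fa_round L (informed L s t).
Proof. exact: iterS. Qed.

Lemma sub_informedS L s t : {subset informed L s t <= informed L s t.+1}.
Proof. by apply/subsetP; rewrite informedS fa_round_sub. Qed.

Lemma informed_nil L s t : L s = [::] -> informed L s t = [set s].
Proof.
move=> Ls; elim: t => [//|t IHt]; rewrite informedS IHt.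
apply/setP=> u; rewrite inE; apply/fa_roundP/eqP => [[/set1P//|]|->].
  by case=> v [r1 [r2 [/set1P-> ]]]; rewrite Ls; case: r1.
by left; rewrite inE.
Qed.

Lemma card_fa_round L I : #|fa_round L I| <= #|I|.*2.
Proof.
rewrite -addnn (leq_trans (leq_card_setU _ _)) // leq_add2l.
(* The default [v] for a missing target is harmless: the image only has to contain all targets. *)
apply: leq_trans (leq_imset_card (fun v => odflt v (target L I v)) I).
apply/subset_leq_card/subsetP=> u; rewrite inE => /exists_inP[v vI /eqP tv].
by apply/imsetP; exists v; rewrite ?tv.
Qed.

Lemma card_informed L s t : #|informed L s t| <= 2 ^ t.
Proof.
elim: t => [|t IHt]; first by rewrite cards1.
rewrite informedS expnS mul2n (leq_trans (card_fa_round _ _)) //.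
by rewrite leq_double.
Qed.

Lemma informed_up_log L s t :
  informed L s t = [set: G] -> up_log 2 #|G| <= t.
Proof.
by move=> Lst; apply: up_log_min => //; rewrite -cardsT -Lst card_informed.
Qed.

(** The lower bound holds for each source separately, so such lists finish at exactly this time from
    every source. *)
Lemma b_fa_up_log L :
    0 < #|G| -> list_family L ->
    (forall s, informed L s (up_log 2 #|G|) = [set: G]) ->
  b_fa G (up_log 2 #|G|).
Proof.
move=> G_gt0 famL Lfull.
have Lsrc s : b_fa_src L s (up_log 2 #|G|).
  by split=> // t t_lt /informed_up_log; rewrite leqNgt t_lt.
split=> [|L' k _ [[s [Lsk _]] _]]; last exact: informed_up_log Lsk.
exists L => //; split; last by move=> s; exists (up_log 2 #|G|).
by have /card_gt0P[s _] := G_gt0; exists s.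
Qed.

End Rounds.

(** A prefix of [LH v] maps to a prefix of [LG (f v)], so by monotonicity vertices informed from
    elsewhere never delay the copy of [H]. *)
Lemma informed_morph (H G : sgraph) (f : H -> G) (LH : H -> seq H)
    (LG : G -> seq G) (R : H -> seq G) :
    (forall v, LG (f v) = map f (LH v) ++ R v) ->
  forall s t x, x \in informed LH s t -> f x \in informed LG (f s) t.
Proof.
move=> LGf s; elim=> [|t IHt] x; first by rewrite !inE => /eqP->.
rewrite !informedS => /fa_roundP[/IHt fx|[v [r1 [r2 [vI Lv sI]]]]].
  exact: subsetP (fa_round_sub _ _) _ fx.
apply: (@fa_round_send _ _ _ (f v) (map f r1) _ (map f r2 ++ R v)).
- by rewrite LGf Lv map_cat -catA.
- exact: IHt.
- by move=> _ /mapP[y /sI/IHt ? ->].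
Qed.

Definition complete_lists n := complete_graph n -> seq (complete_graph n).

(** The last clause is the idle-vertex invariant, [k.-1] being the state before round [k]. For
    [k = 0] it is vacuous: [n < 1] leaves no source. *)
Definition complete_scheme n k (L : complete_lists n) : Prop :=
  list_family L /\ forall s, informed L s k = [set: complete_graph n] /\
    (n < 2 ^ k -> exists2 v, v \in informed L s k.-1 &
                             {subset L v <= informed L s k.-1}).

(** * Lists on a clique split into two cliques *)

Section Join.
Variables (p q : nat) (LA : complete_lists p) (LB : complete_lists q).
Variables (RA : 'I_p -> seq 'I_q) (RB : 'I_q -> seq 'I_p).

Definition join_lists : complete_lists (p + q) := fun v : 'I_(p + q) =>
  match split v with
  | inl a => map (@lshift p q) (LA a) ++ map (@rshift p q) (RA a)
  | inr b => map (@rshift p q) (LB b) ++ map (@lshift p q) (RB b)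
  end.

Lemma join_lshift a : join_lists (lshift q a) =
  map (@lshift p q) (LA a) ++ map (@rshift p q) (RA a).
Proof. by rewrite /join_lists (unsplitK (inl a)). Qed.

Lemma join_rshift b : join_lists (rshift p b) =
  map (@rshift p q) (LB b) ++ map (@lshift p q) (RB b).
Proof. by rewrite /join_lists (unsplitK (inr b)). Qed.

Lemma join_list_family :
    list_family LA -> list_family LB ->
    (forall a, uniq (RA a)) -> (forall b, uniq (RB b)) ->
  list_family join_lists.
Proof.
move=> famA famB uRA uRB v; case: (split_ordP v) => [a|b] ->.
- have [uA sA] := famA a; rewrite join_lshift; split.
    rewrite cat_uniq !map_inj_uniq ?uA ?uRA ?andbT /=;
      try exact: lshift_inj; try exact: rshift_inj.
    by apply/hasPn=> _ /mapP[y _ ->];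
      apply/mapP=> -[x _ /eqP]; rewrite eq_rlshift.
  move=> u; rewrite mem_cat => /orP[]/mapP[x xL ->];
    rewrite [_ \in _]/(_ != _) ?eq_lrshift // eq_lshift.
  exact: sA.
- have [uB sB] := famB b; rewrite join_rshift; split.
    rewrite cat_uniq !map_inj_uniq ?uB ?uRB ?andbT /=;
      try exact: lshift_inj; try exact: rshift_inj.
    by apply/hasPn=> _ /mapP[y _ ->];
      apply/mapP=> -[x _ /eqP]; rewrite eq_lrshift.
  move=> u; rewrite mem_cat => /orP[]/mapP[x xL ->];
    rewrite [_ \in _]/(_ != _) ?eq_rlshift // eq_rshift.
  exact: sB.
Qed.

Lemma informed_lshift s t x :
  x \in informed LA s t -> lshift q x \in informed join_lists (lshift q s) t.
Proof.
exact: (@informed_morph (complete_graph p) (complete_graph (p + q)) _ _ _ _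
         join_lshift).
Qed.

Lemma informed_rshift s t x :
  x \in informed LB s t -> rshift p x \in informed join_lists (rshift p s) t.
Proof.
exact: (@informed_morph (complete_graph q) (complete_graph (p + q)) _ _ _ _
         join_rshift).
Qed.

End Join.

Lemma complete_scheme1 k : exists L : complete_lists 1, complete_scheme k L.
Proof.
exists (fun _ => [::]); split=> [v|s]; first by split.
have infE t : informed (fun _ : complete_graph 1 => [::]) s t = [set s].
  exact: informed_nil.
rewrite !infE; split; last by exists s; rewrite ?inE.
by apply/setP=> x; rewrite !inE; apply/eqP/val_inj; rewrite /= !ord1.
Qed.

Lemma complete_scheme_double m k (L : complete_lists m) :
    0 < m -> complete_scheme k L ->
  exists L2 : complete_lists (m + m), complete_scheme k.+1 L2.
Proof.
move=> m_gt0 [famL Lfull]; pose R (a : 'I_m) := [:: a].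
pose L2 := join_lists L L R R; exists L2.
have L2l y : L2 (lshift m y) = map (@lshift m m) (L y) ++ [:: rshift m y].
  exact: join_lshift.
have L2r y : L2 (rshift m y) = map (@rshift m m) (L y) ++ [:: lshift m y].
  exact: join_rshift.
split=> [|s]; first exact: join_list_family.
(* [0 < m] excludes [k = 0], so [k.-1] really is one round earlier. *)
have idleK : m + m < 2 ^ k.+1 -> k = k.-1.+1 /\ m < 2 ^ k.
  by rewrite expnS; case: (k) => [|k']; rewrite ?expn0 /=; lia.
case: (split_ordP s) => [a|b] ->.
- have [La idle] := Lfull a.
  have allA x : lshift m x \in informed L2 (lshift m a) k.
    by apply: informed_lshift; rewrite La inE.
  split=> [|/idleK[kE /idle[v vI sv]]].
    apply/setP=> x; rewrite [RHS]inE.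
    case: (split_ordP x) => y ->; first exact: sub_informedS.
    rewrite informedS.
    apply: (fa_round_send (L2l y) (allA _)).
    by move=> _ /mapP[z _ ->].
  exists (lshift m v); rewrite /= ?allA //.
  move=> u; rewrite L2l mem_cat => /orP[/mapP[z _ ->] //|].
  rewrite inE => /eqP->; rewrite kE informedS.
  apply: (fa_round_send (L2l v)).
    exact: informed_lshift.
  by move=> _ /mapP[z /sv zI ->]; apply: informed_lshift.
- have [Lb idle] := Lfull b.
  have allB x : rshift m x \in informed L2 (rshift m b) k.
    by apply: informed_rshift; rewrite Lb inE.
  split=> [|/idleK[kE /idle[v vI sv]]].
    apply/setP=> x; rewrite [RHS]inE.
    case: (split_ordP x) => y ->; last exact: sub_informedS.
    rewrite informedS.
    apply: (fa_round_send (L2r y) (allB _)).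
    by move=> _ /mapP[z _ ->].
  exists (rshift m v); rewrite /= ?allB //.
  move=> u; rewrite L2r mem_cat => /orP[/mapP[z _ ->] //|].
  rewrite inE => /eqP->; rewrite kE informedS.
  apply: (fa_round_send (L2r v)).
    exact: informed_rshift.
  by move=> _ /mapP[z /sv zI ->]; apply: informed_rshift.
Qed.

Lemma complete_scheme_doubleS m k (LA : complete_lists m.+1)
    (LB : complete_lists m) :
    0 < m -> m < 2 ^ k -> complete_scheme k LA -> complete_scheme k LB ->
  exists L2 : complete_lists (m.+1 + m), complete_scheme k.+1 L2.
Proof.
move=> m_gt0 m_lt [famA fullA] [famB fullB].
have kE : k = k.-1.+1 by case: (k) m_lt => //; rewrite expn0; lia.
pose a' : 'I_m.+1 := ord0.
have [a0 [l LAa']] : exists a0 l, LA a' = a0 :: l.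
  case LAa': (LA a') => [|a0 l]; last by exists a0, l.
  (* With an empty list, [a'] would remain the only informed vertex, although [A] has at least
     two. *)
  have [+ _] := fullA a'; rewrite informed_nil //.
  move=> /(congr1 (fun A : {set _} => #|A|)).
  by rewrite cards1 cardsT card_ord; lia.
have a'N0 : a0 != a'.
  have [_ /(_ a0)] := famA a'; rewrite LAa' mem_head => /(_ isT).
  by rewrite [_ \in _]/(_ != _) eq_sym.
(* [lift a0] is the matching of [B] with [A - a0]; [unlift] gives [a0] no partner. *)
pose RA (a : 'I_m.+1) : seq 'I_m := seq_of_opt (unlift a0 a).
(* [undup] merges the two entries when the partner of [b] is [a']. *)
pose RB (b : 'I_m) := undup [:: a'; lift a0 b].
pose L2 := join_lists LA LB RA RB; exists L2.
have RAlift b : RA (lift a0 b) = [:: b] by rewrite /RA liftK.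
split=> [|s].
  apply: join_list_family => // [a|b]; last exact: undup_uniq.
  by rewrite /RA; case: unlift.
case: (split_ordP s) => [a|b] ->.
- have [La _] := fullA a.
  have allA x : lshift m x \in informed L2 (lshift m a) k.
    by apply: informed_lshift; rewrite La inE.
  split=> [|_].
    apply/setP=> x; rewrite [RHS]inE.
    case: (split_ordP x) => y ->; first exact: sub_informedS.
    rewrite informedS.
    have L2y : L2 (lshift m (lift a0 y)) =
        map (@lshift m.+1 m) (LA (lift a0 y)) ++ [:: rshift m.+1 y].
      by rewrite /L2 join_lshift RAlift.
    by apply: (fa_round_send L2y (allA _)) => _ /mapP[z _ ->].
  exists (lshift m a0); rewrite /= ?allA //.
  move=> u; rewrite /L2 join_lshift mem_cat => /orP[/mapP[z _ ->] //|].
  by rewrite /RA unlift_none.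
- have [Lb /(_ m_lt)[v vI sv]] := fullB b.
  have allB x : rshift m.+1 x \in informed L2 (rshift m.+1 b) k.
    by apply: informed_rshift; rewrite Lb inE.
  have a'I : lshift m a' \in informed L2 (rshift m.+1 b) k.
    have [r2 RBv] : exists r2, RB v = a' :: r2.
      rewrite /RB /=; case: ifP; last by exists [:: lift a0 v].
      by rewrite inE => /eqP<-; exists [::].
    have L2v : L2 (rshift m.+1 v) =
        map (@rshift m.+1 m) (LB v) ++ lshift m a' :: map (@lshift m.+1 m) r2.
      by rewrite /L2 join_rshift RBv.
    rewrite kE informedS; apply: (fa_round_send L2v).
      exact: informed_rshift.
    by move=> _ /mapP[z /sv zI ->]; apply: informed_rshift.
  split=> [|_].
    apply/setP=> x; rewrite [RHS]inE.
    case: (split_ordP x) => y ->; last exact: sub_informedS.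
    case: (unliftP a0 y) => [c|] ->; last first.
      rewrite informedS.
      have L2a' : L2 (lshift m a') = [::] ++ lshift m a0 ::
          (map (@lshift m.+1 m) l ++ map (@rshift m.+1 m) (RA a')).
        by rewrite /L2 join_lshift LAa'.
      exact: (fa_round_send L2a').
    have [<-|cNa'] := eqVneq a' (lift a0 c); first exact: sub_informedS.
    (* In round [k.+1], [c] skips [a'], informed by then, and reaches its partner. *)
    have L2c : L2 (rshift m.+1 c) = rcons (map (@rshift m.+1 m) (LB c))
        (lshift m a') ++ [:: lshift m (lift a0 c)].
      by rewrite cat_rcons /L2 join_rshift /RB /= inE (negPf cNa').
    rewrite informedS; apply: (fa_round_send L2c (allB _)) => z.
    by rewrite mem_rcons inE => /orP[/eqP-> //|/mapP[w _ ->]].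
  have [w a'E _] := unlift_some a'N0.
  exists (rshift m.+1 w); rewrite /= ?allB //.
  move=> u; rewrite /L2 join_rshift mem_cat => /orP[/mapP[z _ ->] //|].
  by case/mapP=> z; rewrite /RB mem_undup -a'E !inE orbb => /eqP-> ->.
Qed.

Lemma complete_scheme_exists k n :
  0 < n <= 2 ^ k -> exists L : complete_lists n, complete_scheme k L.
Proof.
elim: k n => [|k IHk] n /andP[n_gt0 n_le].
  by have -> : n = 1 by [lia]; apply: complete_scheme1.
rewrite expnS in n_le.
have [m [nE|nE]] : exists m, n = m + m \/ n = m.+1 + m.
  by exists n./2; case: (boolP (odd n)); lia.
- have [|L schL] := IHk m; first by lia.
  by rewrite nE; apply: complete_scheme_double schL; lia.
- have [m0|m_gt0] := posnP m; first by rewrite nE m0; apply: complete_scheme1.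
  (* [2 m + 1 <= 2 * 2 ^ k] forces [m < 2 ^ k]: [A] fits the induction hypothesis and [B] has an
     idle vertex. *)
  have [|LA schA] := IHk m.+1; first by lia.
  have [|LB schB] := IHk m; first by lia.
  by rewrite nE; apply: complete_scheme_doubleS schA schB; lia.
Qed.

(* up_log 2 n is the ceiling of the base-2 logarithm of n >= 1. *)
Theorem theorem1 (n : nat) (n_ge1 : 1 <= n) :
  (exists G : sgraph,
     [/\ connected G, #|G| = n, b_fa G (up_log 2 n) &
         exists2 L : G -> seq G, list_family L &
           forall s : G, informed L s (up_log 2 n) = [set: G]]) /\
  b_fa (complete_graph n) (up_log 2 n).
Proof.
have [|L [famL schL]] := @complete_scheme_exists (up_log 2 n) n.
  by rewrite n_ge1 up_logP.
have fullL s : informed L s (up_log 2 n) = [set: complete_graph n].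
  by have [] := schL s.
have card_n : #|complete_graph n| = n by rewrite /= card_ord.
have bfa_n : b_fa (complete_graph n) (up_log 2 n).
  have := @b_fa_up_log (complete_graph n) L; rewrite card_n; exact.
split=> //; exists (complete_graph n); split=> //; last by exists L.
move=> x y; have [->|xNy] := eqVneq x y; first exact: connect0.
exact: connect1.
Qed.
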